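(* Let $f:\mathbb{R}^n\to\mathbb{R}$, $g:\mathbb{R}^n\to\mathbb{R}^m$, $h:\mathbb{R}^n\to\mathbb{R}^p$ be continuously differentiable, let $\kappa<n$ be an integer, and let $x^*$ be a local minimizer of the cardinality-constrained problem (CCOP) $\min f(x)$ subject to $g(x)\le 0$, $h(x)=0$, $\|x\|_0\le\kappa$. Then $x^*$ is a CC-PAM-stationary point.
   Context: Here $\|x\|_0$ is the number of nonzero components of $x$. $\nabla g(x)\in\mathbb{R}^{n\times m}$ and $\nabla h(x)\in\mathbb{R}^{n\times p}$ have columns $\nabla g_i(x)$ and $\nabla h_j(x)$. Notation: $I_g(x)=\{i: g_i(x)=0\}$, $I_\pm(x)=\{\imath: x_\imath\ne 0\}$. CC-PAM-stationary: a point $x^*$ feasible for CCOP is CC-PAM-stationary if there is a sequence $\{(x^k,\lambda^k,\mu^k,\gamma^k)\}\subset\mathbb{R}^n\times\mathbb{R}^m_+\times\mathbb{R}^p\times\mathbb{R}^n$ such that, with $\pi_k=\|(1,\lambda^k,\mu^k,\gamma^k)\|_\infty$, for all sufficiently large $k$: (a) $x^k\to x^*$ and $\nabla f(x^k)+\nabla g(x^k)\lambda^k+\nabla h(x^k)\mu^k+\gamma^k\to 0$; (b) $\lambda_i^k=0$ for all $i\notin I_g(x^* )$, and $\gamma_\imath^k=0$ for all $\imath\in I_\pm(x^* )$; (c) $\lambda_i^k g_i(x^k)>0$ for every $i$ with $\lim_k \lambda_i^k/\pi_k>0$; (d) $\mu_j^k h_j(x^k)>0$ for every $j$ with $\lim_k|\mu_j^k|/\pi_k>0$;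 (e) $\gamma_\imath^k x_\imath^k>0$ for every $\imath$ with $\lim_k|\gamma_\imath^k|/\pi_k>0$. The bounded sequence $(\lambda^k,\mu^k,\gamma^k)/\pi_k$ is understood to converge (after passing to a subsequence), so that the limits in (c)-(e) exist. *)

(* Defs.v *)
From HB Require Import structures.
From mathcomp Require Import all_boot all_order all_algebra.
From mathcomp Require Import all_classical all_reals all_analysis.

Set Implicit Arguments.
Unset Strict Implicit.
Unset Printing Implicit Defensive.

Import Order.TTheory GRing.Theory Num.Theory.
Import numFieldNormedType.Exports.

Local Open Scope classical_set_scope.
Local Open Scope ring_scope.

(* Vectors of R^n are row vectors ['rV[R]_n], as in the library's Jacobian. *)

(* In finite dimension, continuity of [x |-> 'D_v F x] for every [v] is
   continuity of the differential (equivalently, of the Jacobian matrix). *)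
Definition continuously_differentiable (R : realType) (n : nat)
    (W : normedModType R) (F : 'rV[R]_n -> W) : Prop :=
  (forall x, differentiable F x) /\ (forall v, continuous ('D_v F)).

Definition gradient (R : realType) (n : nat) (f : 'rV[R]_n -> R)
    (x : 'rV[R]_n) : 'rV[R]_n :=
  \row_(i < n) 'D_(delta_mx 0 i) f x.

Definition norm0 (R : realType) (n : nat) (x : 'rV[R]_n) : nat :=
  #|[pred i : 'I_n | x 0 i != 0]|.

Definition ccop_feasible (R : realType) (n m p : nat)
    (g : 'rV[R]_n -> 'rV[R]_m) (h : 'rV[R]_n -> 'rV[R]_p) (kappa : int)
    (x : 'rV[R]_n) : Prop :=
  [/\ forall i, g x 0 i <= 0, h x = 0 & (norm0 x)%:Z <= kappa].

Definition ccop_local_minimizer (R : realType) (n m p : nat)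
    (f : 'rV[R]_n -> R) (g : 'rV[R]_n -> 'rV[R]_m) (h : 'rV[R]_n -> 'rV[R]_p)
    (kappa : int) (xs : 'rV[R]_n) : Prop :=
  ccop_feasible g h kappa xs /\
  \forall y \near xs, ccop_feasible g h kappa y -> f xs <= f y.

(* The library norms on row vectors and on products are max norms, so this is
   the infinity norm of the concatenated vector (1, lam, mu, gam). *)
Definition multiplier_norm (R : realType) (n m p : nat)
    (lam : 'rV[R]_m) (mu : 'rV[R]_p) (gam : 'rV[R]_n) : R :=
  `|(1 : R, lam, mu, gam)|.

(* ['J g x] is the n x m matrix whose i-th column is the gradient of g_i at x;
   the transposes come from the row-vector convention. *)
Definition lagrangian_residual (R : realType) (n m p : nat)
    (f : 'rV[R]_n -> R) (g : 'rV[R]_n -> 'rV[R]_m) (h : 'rV[R]_n -> 'rV[R]_p)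
    (x : 'rV[R]_n) (lam : 'rV[R]_m) (mu : 'rV[R]_p) (gam : 'rV[R]_n)
    : 'rV[R]_n :=
  gradient f x + lam *m ('J g x)^T + mu *m ('J h x)^T + gam.

(* Convergence of the normalized multipliers is part of the definition:
   [limn] is meaningful only for convergent sequences. *)
Definition CC_PAM_stationary (R : realType) (n m p : nat)
    (f : 'rV[R]_n -> R) (g : 'rV[R]_n -> 'rV[R]_m) (h : 'rV[R]_n -> 'rV[R]_p)
    (kappa : int) (xs : 'rV[R]_n) : Prop :=
  ccop_feasible g h kappa xs /\
  exists (x : nat -> 'rV[R]_n) (lam : nat -> 'rV[R]_m)
         (mu : nat -> 'rV[R]_p) (gam : nat -> 'rV[R]_n),
  let rho k := multiplier_norm (lam k) (mu k) (gam k) in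
  (forall k i, 0 <= lam k 0 i) /\
  cvgn (fun k => (rho k)^-1 *: (lam k, mu k, gam k)) /\
  x @ \oo --> xs /\
  (fun k => lagrangian_residual f g h (x k) (lam k) (mu k) (gam k)) @ \oo
    --> (0 : 'rV[R]_n) /\
  \forall k \near \oo,
    [/\ (forall i, g xs 0 i != 0 -> lam k 0 i = 0) /\
        (forall l, xs 0 l != 0 -> gam k 0 l = 0),
        forall i, 0 < limn (fun j => lam j 0 i / rho j) ->
          0 < lam k 0 i * g (x k) 0 i,
        forall i, 0 < limn (fun j => `|mu j 0 i| / rho j) ->
          0 < mu k 0 i * h (x k) 0 i
      & forall l, 0 < limn (fun j => `|gam j 0 l| / rho j) ->
          0 < gam k 0 l * x k 0 l].

(* Main.v *)
(* Near xs, every point vanishing off the support of xs is as sparse as xs, so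
   xs is a local minimizer of f under the smooth constraints g <= 0, h = 0 and
   x_l = 0 for every l with xs_l = 0.  Minimizing
     f(x) + |x - xs|^2 + K (|max(g(x),0)|^2 + |h(x)|^2 + sum of those x_l^2)
   over a small closed ball, with K tending to infinity, gives interior
   minimizers converging to xs.  Stationarity there says that the multipliers
   2K max(g,0), 2K h and 2K x_l leave the residual 2(xs - x), and they have the
   signs of g, h and x_l by construction. *)
Require Import Defs.
From HB Require Import structures.
From mathcomp Require Import all_boot all_order all_algebra.
From mathcomp Require Import all_classical all_reals all_analysis.
From mathcomp Require Import lra ring.
Set Implicit Arguments.
Unset Strict Implicit.

Import Order.TTheory GRing.Theory Num.Theory.
Import numFieldNormedType.Exports.
Local Open Scope classical_set_scope.
Local Open Scope ring_scope.

(** * Subsequences, first-order conditions, derivatives of sums of squares *)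

(** Compactness gives a cluster point [l], and [phi k] picks an index beyond [k] at distance below
    [1/(k+1)] from [l]. The bound [k <= phi k], without monotonicity, is enough to carry limits
    along [phi]. *)
Lemma compact_cvg_subsequence (R : realType) (V : normedModType R) (A : set V)
    (u : nat -> V) : compact A -> (forall k, A (u k)) ->
  exists phi : nat -> nat, (forall k, (k <= phi k)%N) /\
    exists2 l, A l & u \o phi @ \oo --> l.
Proof.
move=> cA Au.
have [|l [Al ul]] := cA (u @ \oo) _; first by exists 0%N => // k _; exact: Au.
have /choice[phi phiP] : forall k, exists j,
    (k <= j)%N /\ `|l - u j| < k.+1%:R^-1.
  move=> k.
  have [||_ [[j kj <-] lj]] :=
    ul (u @` [set j | (k <= j)%N]) (ball l k.+1%:R^-1).
  - by exists k => // j kj; exists j.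
  - by apply: nbhsx_ballx; rewrite invr_gt0.
  by exists j; split=> //; rewrite -ball_normE in lj.
exists phi; split; first by move=> k; case: (phiP k).
exists l => //; apply/cvgrPdist_lt => e e0; near=> k.
have [_ /lt_trans] := phiP k; apply.
near: k; exact: (near_infty_natSinv_lt (PosNum e0)).
Unshelve. all: by end_near. Qed.

Lemma cvg_natge (phi : nat -> nat) : (forall k, (k <= phi k)%N) ->
  phi @ \oo --> \oo.
Proof.
move=> phik B [N _ NB]; exists N => // k Nk; apply: NB.
exact: leq_trans Nk (phik k).
Qed.

(** Fermat's rule in one variable, applied to the restriction of [F] to the line through [x] in
    direction [v]. Derivability at every [y] makes this restriction derivable on a whole interval
    around 0. *)
Lemma is_derive_local_min_eq0 (R : realType) (V : normedModType R) (F : V -> R)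
    (x v : V) (d : R) : (forall y, derivable F y v) ->
  (\forall y \near x, F x <= F y) -> is_derive x v F d -> d = 0.
Proof.
move=> dF xmin [_ <-].
pose phi (t : R) := F (t *: v + x).
have dphi t : derivable phi t 1.
  apply/derivable1P.
  rewrite (_ : (fun h => _) = fun h => F (h *: v + (t *: v + x))).
    exact: (derivable1P F _ v).1 (dF _).
  by apply/funext => h; rewrite /phi [_%:A]mulr1 scalerDl addrA.
have phi0 : \forall t \near (0 : R), phi 0 <= phi t.
  have : (t *: v + x @[t --> (0 : R)] --> x).
    rewrite -[X in _ --> X]add0r -(scale0r v); apply: cvgD; last exact: cvg_cst.
    by apply: cvgZr_tmp; exact: cvg_id.
  by move=> /(_ _ xmin); rewrite /phi scale0r add0r.
move: phi0 => /nbhs_ballP[e /= e0 be].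
have := @derive1_at_min R phi (- e) e 0 _ _ _ _.
case=> //.
- by rewrite ge0_cp // ltW.
- by rewrite in_itv /= oppr_lt0 e0.
- move=> t; rewrite in_itv/= => te; apply: be.
  by rewrite -ball_normE /= sub0r normrN ltr_norml.
move=> _ <-; rewrite /derive.
rewrite [in RHS](_ : (fun h => _) =
    fun h => h^-1 *: ((F \o shift x) (h *: v) - F x)) //.
by apply/funext => h; rewrite /phi /= addr0 scale0r add0r [_%:A]mulr1.
Qed.

(** One formula for all quadratic terms of the penalized objective: [G] will be [g], [h] or the
    identity. *)
Lemma is_derive_weighted_squares (R : realType) (n m : nat) (w : 'I_m -> R)
    (G : 'rV[R]_n -> 'rV[R]_m) (c : 'rV[R]_m) (x v : 'rV[R]_n) :
  differentiable G x ->
  is_derive x v (fun y => \sum_(i < m) w i * (G y 0 i - c 0 i) ^+ 2)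
    (\sum_(i < m) 2 * w i * (G x 0 i - c 0 i) * ('D_v G x) 0 i).
Proof.
move=> dG; have dGv := diff_derivable (v := v) dG.
have dGi i : is_derive x v (fun y => G y 0 i) (('D_v G x) 0 i).
  apply: DeriveDef; first by move/derivable_mxP : dGv; exact.
  by rewrite derive_mx // mxE.
have -> : (fun y => \sum_(i < m) w i * (G y 0 i - c 0 i) ^+ 2) =
    \sum_(i < m) w i *: ((fun y => G y 0 i) - cst (c 0 i)) ^+ 2.
  apply/funext => y; rewrite fct_sumE; apply: eq_bigr => i _.
  by rewrite /GRing.scale /= exprfctE.
apply: is_derive_eq; apply: eq_bigr => i _.
rewrite /GRing.scale /= subr0 expr1 /cst !fctE; ring.
Qed.

(** * Convergence of the penalty minimizers *)

Lemma compact_closed_ball (R : realType) (n : nat) (xs : 'rV[R]_n) (e : R) :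
  0 < e -> compact (closed_ball xs e).
Proof.
move=> e0; apply: bounded_closed_compact; last exact: closed_ball_closed.
exists (`|xs| + e); split; first exact: num_real.
move=> M /ltW eM y; rewrite closed_ballE // /closed_ball_ /= => yxs.
apply: le_trans eM; have := ler_normB xs (xs - y).
by rewrite subKr => /le_trans; apply; rewrite lerD2l.
Qed.

(** Comparison with [xs], where [q] and [P] vanish, bounds the penalized minima by [f xs]. At a
    limit point [l] this forces [P l = 0] and [f l + q l <= f xs], while local minimality gives
    [f xs <= f l]; so [q l = 0]. *)
Lemma penalty_minimizers_cvg (R : realType) (n : nat) (f q P : 'rV[R]_n -> R)
    (xs : 'rV[R]_n) :
  continuous f -> continuous q -> continuous P ->
  q xs = 0 -> (forall y, 0 <= q y) -> (forall y, q y = 0 -> y = xs) ->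
  P xs = 0 -> (forall y, 0 <= P y) ->
  (\forall y \near xs, P y = 0 -> f xs <= f y) ->
  exists (x : nat -> 'rV[R]_n) (K : nat -> R),
    [/\ forall k, 0 < K k, x @ \oo --> xs &
      \forall k \near \oo, \forall y \near x k,
        f (x k) + q (x k) + K k * P (x k) <= f y + q y + K k * P y].
Proof.
move=> cf cq cP qxs q0 qeq Pxs P0 /nbhs_ballP[e /= e0 emin].
(* Half the radius keeps the closed ball inside the open ball where [xs] is minimal. *)
pose A := closed_ball xs (e / 2).
have e20 : 0 < e / 2 by rewrite divr_gt0.
have Axs : A xs by exact: closed_ballxx.
have cA : compact A by exact: compact_closed_ball.
pose F k y := f y + q y + k.+1%:R * P y.
have cF k : continuous (F k).
  move=> y; apply: (@continuousD _ _ _ (f \+ q) (cst k.+1%:R \* P)).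
    by apply: continuousD; [exact: cf|exact: cq].
  by apply: continuousM; [exact: cst_continuous|exact: cP].
have /choice[X XP] : forall k, exists x, A x /\ forall y, A y -> F k x <= F k y.
  move=> k; have [||x xA xmin] := @EVT_min_rV R n (F k) A _ cA.
  - by exists xs.
  - exact: continuous_subspaceT.
  exists x; split; first by rewrite inE in xA.
  by move=> y Ay; apply: xmin; rewrite inE.
have XA k : A (X k) by case: (XP k).
have [phi [phik [l Al Xl]]] := compact_cvg_subsequence cA XA.
have cl (G : 'rV[R]_n -> R) :
    continuous G -> G (X (phi k)) @[k --> \oo] --> G l.
  by move=> cG; apply: continuous_cvg => //; exact: cG.
have FX k : F k (X k) <= f xs.
  by case: (XP k) => _ /(_ _ Axs); rewrite /F qxs Pxs mulr0 !addr0.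
have Pl : P l = 0.
  apply/eqP; rewrite eq_le P0 andbT.
  (* Since [q >= 0], the bound [FX] yields [P (X k) <= (f xs - f (X k)) / (k+1)], and the right side
     tends to 0 along [phi]. *)
  have h0 : (phi k).+1%:R^-1 * (f xs - f (X (phi k))) @[k --> \oo] -->
      0 * (f xs - f l).
    apply: cvgM; last by apply: cvgB; [exact: cvg_cst|exact: cl].
    exact: (cvg_comp _ _ (cvg_natge phik) (@cvg_harmonic R)).
  rewrite mul0r in h0; apply: ler_cvg_to (cl _ cP) h0 _; near=> k.
  rewrite ler_pdivlMl // lerBrDl; apply: le_trans (FX (phi k)).
  by rewrite /F lerD2r lerDl.
have le_l : f l + q l <= f xs.
  apply: ler_cvg_to (cvgD (cl _ cf) (cl _ cq)) (cvg_cst (f xs)) _; near=> k.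
  by apply: le_trans (FX (phi k)); rewrite /F lerDl mulr_ge0.
have le_xs : f xs <= f l.
  apply: emin => //; move: Al.
  rewrite /A closed_ballE // /closed_ball_ -ball_normE /= => /le_lt_trans; apply.
  by rewrite ltr_pdivrMr // ltr_pMr // ltr1n.
have lxs : l = xs by apply: qeq; apply/eqP; rewrite eq_le q0 andbT; lra.
exists (X \o phi), (fun k => (phi k).+1%:R); split => //; first by rewrite -lxs.
(* Once the minimizer lies in the open ball, minimality over the closed ball is local minimality in
   the whole space. *)
have : \forall k \near \oo, ball xs (e / 2) (X (phi k)).
  by rewrite -lxs; apply: Xl; exact: nbhsx_ballx.
apply: filterS => k Xk; near=> y.
have [_] := XP (phi k); apply; apply: subset_closed_ball; near: y.
by apply: open_nbhs_nbhs; split => //; exact: ball_open.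
Unshelve. all: by end_near. Qed.

(** * Multipliers and stationarity of the penalized problem *)

Lemma trmx_jacobian_coord (R : realType) (n m : nat)
    (G : 'rV[R]_n -> 'rV[R]_m) (x : 'rV[R]_n) (i : 'I_m) (l : 'I_n) :
  differentiable G x -> ('J G x)^T i l = ('D_(delta_mx 0 l) G x) 0 i.
Proof.
by move=> dG; rewrite deriveEjacobian // -rowE [in LHS]mxE [in RHS]mxE.
Qed.

(** Euclidean, because the square of the max norm on row vectors is not smooth in general. *)
Definition square_distance (R : realType) (n : nat) (xs y : 'rV[R]_n) : R :=
  \sum_(l < n) (y 0 l - xs 0 l) ^+ 2.

Definition violation (R : realType) (n m p : nat)
    (g : 'rV[R]_n -> 'rV[R]_m) (h : 'rV[R]_n -> 'rV[R]_p)
    (xs y : 'rV[R]_n) : R :=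
  \sum_(i < m) Num.max (g y 0 i) 0 ^+ 2 + \sum_(j < p) h y 0 j ^+ 2 +
  \sum_(l < n) (xs 0 l == 0)%:R * y 0 l ^+ 2.

(** This and the next two definitions collect the coefficients of the gradients of [g_i], [h_j] and
    the coordinates in the gradient of [K * violation]. *)
Definition inequality_multiplier (R : realType) (n m : nat)
    (g : 'rV[R]_n -> 'rV[R]_m) (K : R) (x : 'rV[R]_n) : 'rV[R]_m :=
  \row_(i < m) (2 * K * Num.max (g x 0 i) 0).

Definition equality_multiplier (R : realType) (n p : nat)
    (h : 'rV[R]_n -> 'rV[R]_p) (K : R) (x : 'rV[R]_n) : 'rV[R]_p :=
  \row_(j < p) (2 * K * h x 0 j).

Definition sparsity_multiplier (R : realType) (n : nat) (xs : 'rV[R]_n)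
    (K : R) (x : 'rV[R]_n) : 'rV[R]_n :=
  \row_(l < n) (2 * K * (xs 0 l == 0)%:R * x 0 l).

Lemma sum_mul_delta (R : realType) (n : nat) (a : 'I_n -> R) (l : 'I_n) :
  \sum_(j < n) a j * (delta_mx 0 l : 'rV[R]_n) 0 j = a l.
Proof.
rewrite (bigD1 l) //= mxE !eqxx mulr1 big1 ?addr0 // => j /negbTE jl.
by rewrite mxE jl andbF mulr0.
Qed.

(** [Num.max a 0] is the distance from [a] to the half-line of nonpositive reals, and [Num.min b 0]
    is a point of that half-line. *)
Lemma sqr_max0_le (R : realType) (a b : R) :
  Num.max a 0 ^+ 2 <= (a - Num.min b 0) ^+ 2.
Proof.
have [_|a0] := leP a 0; first by rewrite expr0n /= sqr_ge0.
have [b0|_] := leP b 0; last by rewrite subr0.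
by rewrite lerXn2r ?nnegrE //; lra.
Qed.

(** The derivative along each basis vector vanishes; the distance term contributes [2 *: (x - xs)],
    which moves to the right-hand side. *)
Lemma penalty_minimizer_residual (R : realType) (n m p : nat)
    (f : 'rV[R]_n -> R) (g : 'rV[R]_n -> 'rV[R]_m) (h : 'rV[R]_n -> 'rV[R]_p)
    (xs x : 'rV[R]_n) (K : R) :
  (forall y, differentiable f y) -> (forall y, differentiable g y) ->
  (forall y, differentiable h y) -> 0 < K ->
  (\forall y \near x, f x + square_distance xs x + K * violation g h xs x
    <= f y + square_distance xs y + K * violation g h xs y) ->
  lagrangian_residual f g h x (inequality_multiplier g K x)
    (equality_multiplier h K x) (sparsity_multiplier xs K x) = 2 *: (xs - x).
Proof.
move=> df dg dh K0 xmin; apply/rowP => l.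
set v : 'rV[R]_n := delta_mx 0 l.
(* [max(t,0)^2] is the squared distance of [t] to the negative half-line, so
   replacing the projection of [g_i y] by that of [g_i x] gives a smooth
   majorant of the penalty function that is exact at [x]. *)
pose s : 'rV[R]_m := \row_i Num.min (g x 0 i) 0.
(* Unit weights and zero centers stay explicit so that each sum is an instance of
   [is_derive_weighted_squares]. *)
pose F (y : 'rV[R]_n) := f y + \sum_(l < n) 1 * (y 0 l - xs 0 l) ^+ 2 +
  (\sum_(i < m) K * (g y 0 i - s 0 i) ^+ 2 +
   \sum_(j < p) K * (h y 0 j - (0 : 'rV[R]_p) 0 j) ^+ 2 +
   \sum_(l < n) (K * (xs 0 l == 0)%:R) * (y 0 l - (0 : 'rV[R]_n) 0 l) ^+ 2).
have idd y : differentiable (@id 'rV[R]_n) y by [].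
have dF y := is_deriveD
  (is_deriveD (derivableP (diff_derivable (v := v) (df y)))
    (is_derive_weighted_squares (fun=> 1) xs v (idd y)))
  (is_deriveD (is_deriveD
    (is_derive_weighted_squares (fun=> K) s v (dg y))
    (is_derive_weighted_squares (fun=> K) 0 v (dh y)))
    (is_derive_weighted_squares (fun l => K * (xs 0 l == 0)%:R) 0 v (idd y))).
have Fmin : \forall y \near x, F x <= F y.
  apply: filterS xmin => y xy.
  have FE z : F z - (f z + square_distance xs z + K * violation g h xs z) =
      K * \sum_(i < m) ((g z 0 i - s 0 i) ^+ 2 - Num.max (g z 0 i) 0 ^+ 2).
    rewrite /F /square_distance /violation sumrB -!mulr_sumr.
    have -> : \sum_(j < p) (h z 0 j - (0 : 'rV[R]_p) 0 j) ^+ 2 =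
        \sum_(j < p) h z 0 j ^+ 2.
      by apply: eq_bigr => j _; rewrite mxE subr0.
    have -> : \sum_(l < n) K * (xs 0 l == 0)%:R *
          (z 0 l - (0 : 'rV[R]_n) 0 l) ^+ 2 =
        K * \sum_(l < n) (xs 0 l == 0)%:R * z 0 l ^+ 2.
      by rewrite mulr_sumr; apply: eq_bigr => j _; rewrite mxE subr0 mulrA.
    ring.
  have Fx : F x = f x + square_distance xs x + K * violation g h xs x.
    apply/eqP; rewrite -subr_eq0 FE big1 ?mulr0 // => i _.
    by rewrite mxE; case: (leP (g x 0 i) 0) => _; ring.
  rewrite Fx; apply: (le_trans xy); rewrite -subr_ge0 FE mulr_ge0 ?(ltW K0) //.
  apply: sumr_ge0 => i _; rewrite subr_ge0 mxE; exact: sqr_max0_le.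
have := is_derive_local_min_eq0 (fun y => ex_derive (is_derive := dF y))
  Fmin (dF x).
rewrite !derive_id !sum_mul_delta => D0.
rewrite /lagrangian_residual ![in LHS]mxE.
(* Because [t - min t 0 = max t 0], the majorant has at [x] exactly the coefficients given by the
   multiplier. *)
have -> : \sum_j inequality_multiplier g K x 0 j * ('J g x)^T j l =
    \sum_(i < m) 2 * K * (g x 0 i - s 0 i) * ('D_v g x) 0 i.
  apply: eq_bigr => i _; rewrite trmx_jacobian_coord // !mxE; congr (_ * _).
  by case: (leP (g x 0 i) 0) => _; ring.
have -> : \sum_j equality_multiplier h K x 0 j * ('J h x)^T j l =
    \sum_(i < p) 2 * K * (h x 0 i - (0 : 'rV[R]_p) 0 i) * ('D_v h x) 0 i.
  by apply: eq_bigr => i _; rewrite trmx_jacobian_coord // !mxE subr0.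
move: D0; rewrite !mxE; lra.
Qed.

(** * Zeros and continuity of the penalty terms *)

Lemma square_distance_eq0 (R : realType) (n : nat) (xs y : 'rV[R]_n) :
  square_distance xs y = 0 -> y = xs.
Proof.
move=> /eqP; rewrite psumr_eq0; last by move=> i _; exact: sqr_ge0.
move=> /allP y0; apply/rowP => l; apply/eqP; rewrite -subr_eq0 -sqrf_eq0.
exact: (y0 l (mem_index_enum l)).
Qed.

Lemma violation_ge0 (R : realType) (n m p : nat)
    (g : 'rV[R]_n -> 'rV[R]_m) (h : 'rV[R]_n -> 'rV[R]_p) (xs y : 'rV[R]_n) :
  0 <= violation g h xs y.
Proof.
rewrite /violation !addr_ge0 // sumr_ge0 // => i _; try exact: sqr_ge0.
by rewrite mulr_ge0 ?ler0n ?sqr_ge0.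
Qed.

Lemma violation_eq0P (R : realType) (n m p : nat)
    (g : 'rV[R]_n -> 'rV[R]_m) (h : 'rV[R]_n -> 'rV[R]_p) (xs y : 'rV[R]_n) :
  violation g h xs y = 0 <->
  [/\ forall i, g y 0 i <= 0, h y = 0 & forall l, xs 0 l = 0 -> y 0 l = 0].
Proof.
split=> [/eqP|[gy hy xsy]].
  have ge0 l : 0 <= (xs 0 l == 0)%:R * y 0 l ^+ 2.
    by rewrite mulr_ge0 ?ler0n ?sqr_ge0.
  rewrite /violation !paddr_eq0 ?addr_ge0 ?sumr_ge0 => // [|i _|i _|i _|i _];
    try exact: sqr_ge0.
  rewrite !psumr_eq0 => // [|i _|i _]; try exact: sqr_ge0.
  move=> /andP[/andP[/allP gy /allP hy] /allP xsy]; split.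
  - move=> i; have := gy i (mem_index_enum i).
    by rewrite /= sqrf_eq0; case: leP => // y0; rewrite gt_eqF.
  - apply/rowP => j; have := hy j (mem_index_enum j).
    by rewrite /= sqrf_eq0 mxE => /eqP.
  - move=> l xsl; have := xsy l (mem_index_enum l).
    by rewrite /= xsl eqxx mul1r sqrf_eq0 => /eqP.
rewrite /violation !big1 ?addr0 // => i _.
- by have [/xsy ->|_] := eqVneq (xs 0 i) 0; rewrite ?mul0r ?expr0n ?mulr0.
- by rewrite hy mxE expr0n.
- by rewrite max_r // expr0n.
Qed.

Lemma coord_comp_continuous (R : realType) (T : topologicalType) (m : nat)
    (G : T -> 'rV[R]_m) (i : 'I_m) :
  continuous G -> continuous (fun y => G y 0 i).
Proof.
move=> cG y; apply: (@continuous_comp _ _ _ G (fun v : 'rV[R]_m => v 0 i)).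
  exact: cG.
exact: coord_continuous.
Qed.

Lemma continuous_sum_sqr (R : realType) (T : topologicalType) (m : nat)
    (u : 'I_m -> T -> R) : (forall i, continuous (u i)) ->
  continuous (fun y => \sum_(i < m) u i y ^+ 2).
Proof.
move=> cu; apply: continuous_big; first exact: add_continuous.
by move=> i _ y; apply: (@continuousM _ _ (u i) (u i)); exact: cu.
Qed.

Lemma square_distance_continuous (R : realType) (n : nat) (xs : 'rV[R]_n) :
  continuous (square_distance xs).
Proof.
apply: continuous_sum_sqr => l y; apply: continuousB.
  exact: coord_continuous.
exact: cst_continuous.
Qed.

Lemma violation_continuous (R : realType) (n m p : nat)
    (g : 'rV[R]_n -> 'rV[R]_m) (h : 'rV[R]_n -> 'rV[R]_p) (xs : 'rV[R]_n) :
  continuous g -> continuous h -> continuous (violation g h xs).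
Proof.
move=> cg ch.
have cvg_g : continuous (fun y => \sum_(i < m) Num.max (g y 0 i) 0 ^+ 2).
  apply: continuous_sum_sqr => i y.
  apply: (@continuous_max _ _ (fun z => g z 0 i) (cst 0)).
    exact: coord_comp_continuous.
  exact: cst_continuous.
have cvg_h : continuous (fun y => \sum_(j < p) h y 0 j ^+ 2).
  by apply: continuous_sum_sqr => j; exact: coord_comp_continuous.
have cvg_x : continuous (fun y : 'rV[R]_n =>
    \sum_(l < n) (xs 0 l == 0)%:R * y 0 l ^+ 2).
  apply: continuous_big; first exact: add_continuous.
  move=> l _ y; have cl := @coord_continuous R 1 n 0 l y.
  exact: continuousM (@cst_continuous _ _ _ y) (continuousM cl cl).
by move=> y; exact: continuousD (continuousD (cvg_g y) (cvg_h y)) (cvg_x y).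
Qed.

(** * Normalized multipliers and the stationarity conditions *)

(** The implication sits under the eventual quantifier so that [filter_forall] can treat all of the
    finitely many indices at once, whatever the signs of their limits. *)
Lemma near_limn_gt0 (R : realType) (u : nat -> R) : cvgn u ->
  \forall k \near \oo, 0 < limn u -> 0 < u k.
Proof.
move=> cu; have [u0|u0] := ltP 0 (limn u); last by near=> k.
have : \forall k \near \oo, 0 < u k by exact: (cvgr_gt (limn u)).
by apply: filterS => k uk _.
Unshelve. all: by end_near. Qed.

Unset Implicit Arguments.

Theorem theorem3p1 (R : realType) (n m p : nat)
    (f : 'rV[R]_n -> R) (g : 'rV[R]_n -> 'rV[R]_m) (h : 'rV[R]_n -> 'rV[R]_p)
    (kappa : int) (xs : 'rV[R]_n)
    (hf : continuously_differentiable f)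
    (hg : continuously_differentiable g)
    (hh : continuously_differentiable h)
    (hkappa : kappa < n%:Z)
    (hxs : ccop_local_minimizer f g h kappa xs) :
  CC_PAM_stationary f g h kappa xs.
Proof.
case: hf hg hh => [df _] [dg _] [dh _].
have cf : continuous f by move=> y; exact: differentiable_continuous.
have cg : continuous g by move=> y; exact: differentiable_continuous.
have ch : continuous h by move=> y; exact: differentiable_continuous.
case: hxs => feas locmin; split=> //; case: feas => gxs hxs xs_kappa.
(* A zero of [violation] has its support inside that of [xs], hence satisfies the same cardinality
   bound. *)
have feasible y : violation g h xs y = 0 -> ccop_feasible g h kappa y.
  move=> /violation_eq0P[gy hy y0]; split=> //; apply: le_trans xs_kappa.
  rewrite lez_nat; apply/subset_leq_card/fintype.subsetP => l; rewrite !inE.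
  by apply: contraNneq => /y0 ->.
have sq0 : square_distance xs xs = 0.
  by rewrite /square_distance big1 // => l _; rewrite subrr expr0n.
have sq_ge0 y : 0 <= square_distance xs y.
  by apply: sumr_ge0 => l _; exact: sqr_ge0.
have viol_xs : violation g h xs xs = 0 by apply/violation_eq0P.
have viol_ge0 y : 0 <= violation g h xs y by exact: violation_ge0.
have viol_min : \forall y \near xs, violation g h xs y = 0 -> f xs <= f y.
  by apply: filterS locmin => y fy /feasible.
have [x [K [K0 xxs xmin]]] := penalty_minimizers_cvg cf
  (square_distance_continuous (xs := xs))
  (violation_continuous (xs := xs) cg ch)
  sq0 sq_ge0 (square_distance_eq0 (xs := xs)) viol_xs viol_ge0 viol_min.
pose lam k := inequality_multiplier g (K k) (x k).
pose mu k := equality_multiplier h (K k) (x k).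
pose gam k := sparsity_multiplier xs (K k) (x k).
pose rho k := multiplier_norm (lam k) (mu k) (gam k).
have rho_ge1 k : 1 <= rho k.
  by rewrite /rho /multiplier_norm !prod_normE /= normr1 !le_max lexx.
have rho0 k : 0 < rho k by apply: lt_le_trans (rho_ge1 k).
pose U k := (rho k)^-1 *: (lam k, mu k, gam k).
(* The norm [rho k] dominates each multiplier block, so the normalized triples stay in a product of
   unit balls. A convergent subsequence then reindexes points and multipliers alike. *)
pose A : set ('rV[R]_m * 'rV[R]_p * 'rV[R]_n) :=
  (closed_ball 0 1 `*` closed_ball 0 1) `*` closed_ball 0 1.
have cA : compact A.
  by apply: compact_setX; [apply: compact_setX|]; exact: compact_closed_ball.
have UA k : A (U k).
  have le1 q (v : 'rV[R]_q) : `|v| <= rho k ->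
      closed_ball (0 : 'rV[R]_q) 1 ((rho k)^-1 *: v).
    move=> vk; rewrite closed_ballE // /closed_ball_ /= sub0r normrN normrZ.
    by rewrite gtr0_norm ?invr_gt0 // ler_pdivrMl // mulr1.
  split; [split|]; apply: le1;
    by rewrite /rho /multiplier_norm !prod_normE /= !le_max lexx ?orbT.
have [phi [phik [L _ UL]]] := compact_cvg_subsequence cA UA.
have phioo := cvg_natge phik.
exists (x \o phi), (lam \o phi), (mu \o phi), (gam \o phi) => /=.
have UL1 : (U (phi k)).1 @[k --> \oo] --> L.1.
  exact: (cvg_comp _ _ UL (@cvg_fst _ _ (nbhs L.1) (nbhs L.2) _)).
have UL2 : (U (phi k)).2 @[k --> \oo] --> L.2.
  exact: (cvg_comp _ _ UL (@cvg_snd _ _ (nbhs L.1) (nbhs L.2) _)).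
have UL11 : (U (phi k)).1.1 @[k --> \oo] --> L.1.1.
  exact: (cvg_comp _ _ UL1 (@cvg_fst _ _ (nbhs L.1.1) (nbhs L.1.2) _)).
have UL12 : (U (phi k)).1.2 @[k --> \oo] --> L.1.2.
  exact: (cvg_comp _ _ UL1 (@cvg_snd _ _ (nbhs L.1.1) (nbhs L.1.2) _)).
have coord_cvg q (u : nat -> 'rV[R]_q) (v : 'rV[R]_q) i :
    u k @[k --> \oo] --> v -> u k 0 i @[k --> \oo] --> v 0 i.
  by move=> uv; exact: (cvg_comp _ _ uv (@coord_continuous R 1 q 0 i v)).
have norm_div k (t : R) : `|t| / rho k = `|(rho k)^-1 * t|.
  by rewrite normrM gtr0_norm ?invr_gt0 // mulrC.
have lam_cvg i : cvgn (fun j => lam (phi j) 0 i / rho (phi j)).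
  rewrite (_ : (fun j => _) = fun j => (U (phi j)).1.1 0 i).
    by apply/cvg_ex; exists (L.1.1 0 i); exact: coord_cvg.
  by apply/funext => j; rewrite [in RHS]mxE mulrC.
have mu_cvg i : cvgn (fun j => `|mu (phi j) 0 i| / rho (phi j)).
  rewrite (_ : (fun j => _) = fun j => `|(U (phi j)).1.2 0 i|).
    by apply/cvg_ex; exists `|L.1.2 0 i|; apply: cvg_norm; exact: coord_cvg.
  by apply/funext => j; rewrite norm_div [in RHS]mxE.
have gam_cvg l : cvgn (fun j => `|gam (phi j) 0 l| / rho (phi j)).
  rewrite (_ : (fun j => _) = fun j => `|(U (phi j)).2 0 l|).
    by apply/cvg_ex; exists `|L.2 0 l|; apply: cvg_norm; exact: coord_cvg.
  by apply/funext => j; rewrite norm_div [in RHS]mxE.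
have xphi : x (phi k) @[k --> \oo] --> xs by exact: cvg_comp phioo xxs.
(* An inactive constraint is strictly negative at [xs], hence eventually negative along the
   sequence, and its multiplier is then exactly 0. *)
have g_inactive i : \forall k \near \oo, g xs 0 i != 0 -> g (x (phi k)) 0 i < 0.
  have [_|gi] := eqVneq (g xs 0 i) 0; first by near=> k.
  have gcvg : g (x (phi k)) 0 i @[k --> \oo] --> g xs 0 i.
    by apply: (coord_cvg _ (g \o x \o phi)); exact: (cvg_comp _ _ xphi (cg xs)).
  have : \forall k \near \oo, g (x (phi k)) 0 i < 0.
    by apply: (cvgr_lt _ gcvg); rewrite lt_neqAle gi gxs.
  by apply: filterS => k gk _.
(* Equality and sparsity multipliers are [c * t] with [t] the constraint value, so a nonzero
   multiplier gives the positive product [c * t ^+ 2]. *)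
have sqr_gt0 (c t : R) : 0 < c -> c * t != 0 -> 0 < c * t * t.
  move=> c0; rewrite mulf_eq0 negb_or gt_eqF //= => t0.
  by rewrite -mulrA mulr_gt0 // -expr2 exprn_even_gt0.
split; last split; last split; last split.
- by move=> k i; rewrite mxE mulr_ge0 ?le_max ?lexx ?orbT // mulr_ge0 ?ltW.
- exact: (cvgP L).
- exact: xphi.
- have : 2 *: (xs - x (phi k)) @[k --> \oo] --> 2 *: (xs - xs).
    by apply: cvgZl_tmp; apply: cvgB; [exact: cvg_cst|exact: xphi].
  rewrite subrr scaler0; apply: cvg_trans; apply: near_eq_cvg; near=> k.
  rewrite /= (penalty_minimizer_residual df dg dh (K0 (phi k))) //.
  by near: k; exact: phioo xmin.
near=> k; split; [split| | |].
- move=> i gi; rewrite mxE max_r ?mulr0 // ltW //; move: i gi.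
  by near: k; exact: filter_forall g_inactive.
- by move=> l /negbTE xl; rewrite mxE xl mulr0 mul0r.
- move=> i.
  have : 0 < limn (fun j => lam (phi j) 0 i / rho (phi j)) ->
      0 < lam (phi k) 0 i / rho (phi k).
    move: i; near: k; apply: filter_forall => i; exact: near_limn_gt0.
  move=> /[apply]; rewrite pmulr_lgt0 ?invr_gt0 // mxE.
  (* A positive multiplier excludes [g_i <= 0], where the maximum is 0; so both factors are
     positive. *)
  by case: (leP (g (x (phi k)) 0 i) 0) => [_|g0 lam0];
    [rewrite mulr0 ltxx|rewrite mulr_gt0].
- move=> i.
  have : 0 < limn (fun j => `|mu (phi j) 0 i| / rho (phi j)) ->
      0 < `|mu (phi k) 0 i| / rho (phi k).
    move: i; near: k; apply: filter_forall => i; exact: near_limn_gt0.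
  move=> /[apply]; rewrite pmulr_lgt0 ?invr_gt0 // normr_gt0 mxE.
  by apply: sqr_gt0; rewrite mulr_gt0.
- move=> l.
  have : 0 < limn (fun j => `|gam (phi j) 0 l| / rho (phi j)) ->
      0 < `|gam (phi k) 0 l| / rho (phi k).
    move: l; near: k; apply: filter_forall => l; exact: near_limn_gt0.
  move=> /[apply]; rewrite pmulr_lgt0 ?invr_gt0 // normr_gt0 mxE.
  (* On the support of [xs] the multiplier is 0, against its being nonzero. *)
  have [_|_] := eqVneq (xs 0 l) 0; last by rewrite mulr0 mul0r eqxx.
  by apply: sqr_gt0; rewrite mulr1 mulr_gt0.
Unshelve. all: by end_near. Qed.
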